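(* Let $0<c<\frac14$. Then $$K^{+}=W^{s}(\alpha)\cup W^{s}(\theta)\cup W^{s}(p)\cup W^{s}(f(p))\cup W^{s}(f^2(p)).$$ Moreover $W^{s}(\alpha)=\mathrm{int}(K^{+})$ and $\partial K^{+}=W^{s}(\theta)\cup W^{s}(p)\cup W^{s}(f(p))\cup W^{s}(f^2(p))$, where interior and boundary are taken in $\mathbb{R}^2$.
   Context: For real $c$, $f=f_c:\mathbb{R}^2\to\mathbb{R}^2$ is the map $f(x,y)=(xy+c,x)$, and $K^{+}=\{z\in\mathbb{R}^2:\ (f^n(z))_{n\ge0}\text{ is bounded}\}$. Set $a_1=\frac{1-\sqrt{1-4c}}{2}$, $a_2=\frac{1+\sqrt{1-4c}}{2}$; $\alpha=(a_1,a_1)$ and $\theta=(a_2,a_2)$ are the fixed points of $f$. Set $p=(-1,-1)$, so that $f(p)=(1+c,-1)$, $f^2(p)=(-1,1+c)$ and $f^3(p)=p$. For a periodic point $q$ of $f$, $W^{s}(q)=\{z\in\mathbb{R}^2:\ \|f^n(z)-f^n(q)\|\to 0 \text{ as } n\to+\infty\}$ is its stable manifold. *)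

(* Defs.v *)
From HB Require Import structures.
From mathcomp Require Import all_boot all_order all_algebra.
From mathcomp Require Import all_classical all_reals all_analysis.

Set Implicit Arguments.
Unset Strict Implicit.
Unset Printing Implicit Defensive.

Import Order.TTheory GRing.Theory Num.Theory.
Import numFieldNormedType.Exports.

Local Open Scope classical_set_scope.
Local Open Scope ring_scope.

(* The plane is R * R with the product topology. Its library norm is the
   sup norm; boundedness and convergence do not depend on the choice of
   the norm on the plane. *)

Definition planemap (R : realType) (c : R) (z : R * R) : R * R :=
  (z.1 * z.2 + c, z.1).

Definition Kplus (R : realType) (c : R) : set (R * R) :=
  [set z | [bounded iter n (planemap c) z | n in [set: nat]]].

Definition Ws (R : realType) (c : R) (q : R * R) : set (R * R) :=
  [set z | (fun n : nat => `|iter n (planemap c) z - iter n (planemap c) q|)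
             @ \oo --> (0 : R)].

Definition a1 (R : realType) (c : R) : R := (1 - Num.sqrt (1 - 4 * c)) / 2.

Definition a2 (R : realType) (c : R) : R := (1 + Num.sqrt (1 - 4 * c)) / 2.

Definition alpha (R : realType) (c : R) : R * R := (a1 c, a1 c).

Definition theta (R : realType) (c : R) : R * R := (a2 c, a2 c).

Definition p3 (R : realType) : R * R := (-1, -1).

Definition boundary (T : topologicalType) (A : set T) : set T :=
  closure A `\` interior A.

(* Main.v *)
(* Write [f^n z = (u (n+1), u n)], so that [u (n+2) = u (n+1) * u n + c]. Every
   orbit is eventually nonnegative or eventually has the sign pattern [-,-,+] of
   period 3. In both cases [t n = |u n|] satisfies
   [t (n+2) = t (n+1) * t n + k n] with [k n = c] or [k n = - c] of period 3,
   which is order preserving; hence the subsequences of [t] along an even period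
   are eventually monotone, and a bounded orbit converges to a nonnegative
   periodic solution of the same recurrence. Such a solution is a fixed point in
   the first case and the 3-cycle in the second.

   [K+] is closed because an unbounded orbit enters the open set [|x|, |y| > 2],
   which only contains unbounded orbits, and [W^s(alpha)] is interior because its
   orbits enter the invariant open square [|x|, |y| < 1/2]. Along an orbit
   attracted to [theta] or to the 3-cycle, [t n] eventually exceeds 1/2; then any
   order-increasing perturbation grows without bound, so such a point is not
   interior to [K+]. The perturbation is pulled back along the orbit by the local
   inverse of [f], which exists since no point of the orbit has [x = 0]: such a
   point is mapped to [(c, c)], in the square above. *)

Require Import Defs.
From HB Require Import structures.
From mathcomp Require Import all_boot all_order all_algebra.
From mathcomp Require Import all_classical all_reals all_analysis.
From mathcomp Require Import ring lra zify.

Set Implicit Arguments.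
Unset Strict Implicit.
Unset Printing Implicit Defensive.

Import Order.TTheory GRing.Theory Num.Theory.
Import numFieldNormedType.Exports.
Local Open Scope classical_set_scope.
Local Open Scope ring_scope.

(** * An Archimedean bound and two-step induction *)

Lemma nat_ltr (R : realType) (x : R) : exists n : nat, x < n%:R.
Proof. by exists (Num.bound `|x|); apply: le_lt_trans (ler_norm x) (archi_boundP _). Qed.

Lemma nat_ind2 (P : nat -> Prop) :
  P 0%N -> P 1%N -> (forall n, P n -> P n.+1 -> P n.+2) -> forall n, P n.
Proof.
move=> P0 P1 IH n; have [] : P n /\ P n.+1 by elim: n => // n []; split=> //; exact: IH.
by [].
Qed.

(** * Sign patterns compatible with the recurrence *)

(** For c > 0, the signs of the second coordinates -1, -1, 1 + c along the orbit of [p3]. *)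
Definition pat3 (R : realType) (n : nat) : R :=
  if (n %% 3 == 2)%N then 1 else -1.

(* For such signs [e], [e n * u n] satisfies the recurrence of [u] up to the sign
   of the constant [c], see [twist_rec]. *)
Definition twist (R : realType) (e : nat -> R) : Prop :=
  forall n, `|e n| = 1 /\ e n.+2 = e n.+1 * e n.

Lemma twist1 (R : realType) : twist (fun=> 1 : R).
Proof. by move=> n; rewrite normr1 mulr1. Qed.

Lemma twist_pat3 (R : realType) : twist (pat3 R).
Proof.
move=> n; rewrite /pat3; split; first by case: ifP => _; rewrite ?normrN normr1.
rewrite (divn_eq n 3) -!addnS !modnMDl.
have : (n %% 3 < 3)%N by rewrite ltn_mod.
by case: (n %% 3)%N => [|[|[|]]] //= _; rewrite ?mulr1 ?mul1r ?mulrN1 ?opprK.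
Qed.

Lemma twist_shift (R : realType) (e : nat -> R) (N : nat) :
  twist e -> twist (fun n => e (N + n)%N).
Proof. by move=> he n; rewrite !addnS; exact: he. Qed.

Lemma twist_sqr (R : realType) (e : nat -> R) (n : nat) : twist e -> e n * e n = 1.
Proof. by move=> /(_ n)[en _]; rewrite -expr2 -real_normK ?num_real// en expr1n. Qed.

Lemma twist_rec (R : realType) (c : R) (e u : nat -> R) :
  twist e -> (forall n, u n.+2 = u n.+1 * u n + c) ->
  forall n, e n.+2 * u n.+2 =
    (e n.+1 * u n.+1) * (e n * u n) + e n.+2 * c.
Proof. by move=> he hu n; rewrite hu (he n).2; ring. Qed.

(* If the orbit never has two consecutive nonnegative terms, then after two
   negative terms the signs repeat [-,-,+]; strict alternation is excluded since
   it would force each negative term to be below -1 and at most a quarter of the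
   previous one in absolute value. *)
Lemma sign_dichotomy (R : realType) (c : R) (u : nat -> R) :
  0 < c -> c < 1 / 4 -> (forall n, u n.+2 = u n.+1 * u n + c) ->
  exists N, (forall n, 0 <= u (N + n)%N) \/
            (forall n, 0 < pat3 R n * u (N + n)%N).
Proof.
move=> c0 c1 hu.
have [[N [h0 h1]]|Hnn] := pselect (exists N, 0 <= u N /\ 0 <= u N.+1).
  exists N; left; apply: nat_ind2 => [||n hn hn1]; rewrite ?addn0 ?addn1//.
  by rewrite !addnS hu -addnS; nra.
have H n : u n < 0 \/ u n.+1 < 0.
  have [|h0] := ltP (u n) 0; first by left.
  have [|h1] := ltP (u n.+1) 0; first by right.
  by exfalso; apply: Hnn; exists n.
have [[N [h0 h1]]|Hneg] := pselect (exists N, u N < 0 /\ u N.+1 < 0).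
  have step n : u n < 0 -> u n.+1 < 0 ->
      [/\ 0 < u n.+2, u n.+3 < 0 & u n.+4 < 0].
    move=> un un1.
    have u2 : c < u n.+2 by rewrite hu; nra.
    have u3 : u n.+3 < 0 by case: (H n.+2) => //; lra.
    split=> //; first lra.
    rewrite ltNge; apply/negP => u4.
    case: (H n.+4) => [|]; first lra.
    (* Suppose w = u(n+4) = y x + c >= 0 with x > c and y < 0. Then y > -1 and w < c, so the next
       term w (y + 1) + (c - w) is positive, against [H]. *)
    have := hu n.+2; have := hu n.+3.
    move: (u n.+2) (u n.+3) (u n.+4) (u n.+4.+1) u2 u3 u4 => x y w v.
    move=> xc y0 w0 -> wE; have -> : w * y + c = w * (y + 1) + (c - w) by ring.
    have y1 : -1 < y by nra.
    by nra.
  exists N; right => n.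
  have blk k : u (N + 3 * k)%N < 0 /\ u (N + 3 * k).+1 < 0.
    elim: k => [|k [b0 b1]]; first by rewrite muln0 addn0.
    have [_ ? ?] := step _ b0 b1.
    by have -> : (N + 3 * k.+1 = (N + 3 * k).+3)%N by lia.
  have [b0 b1] := blk (n %/ 3)%N; have [b2 _ _] := step _ b0 b1.
  rewrite /pat3 {2}(divn_eq n 3) mulnC addnA.
  have : (n %% 3 < 3)%N by rewrite ltn_mod.
  case: (n %% 3)%N => [|[|[|]]] //= _; rewrite ?addn0 ?addn1 ?addn2; lra.
exfalso.
have alt n : u n < 0 -> 0 <= u n.+1 /\ u n.+2 < 0.
  move=> un; have u1 : 0 <= u n.+1.
    by rewrite leNgt; apply/negP => u1; apply: Hneg; exists n.
  by split=> //; case: (H n.+1) => //; lra.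
have [N uN] : exists N, u N < 0.
  by case: (H 0%N) => h; [exists 0%N|exists 1%N].
have [uN1 uN2] := alt _ uN.
have low k : u (N + 2 * k).+2 < 0 /\ u N.+2 + k%:R / 2 <= u (N + 2 * k).+2.
  elim: k => [|k [k0 kl]]; first by rewrite muln0 addn0 mul0r addr0.
  have -> : ((N + 2 * k.+1).+2 = (N + 2 * k).+4)%N by lia.
  have hk : u (N + 2 * k)%N < 0.
    case: k {k0 kl} => [|k]; first by rewrite muln0 addn0.
    have : forall j, u (N + 2 * j)%N < 0.
      elim=> [|j /alt[_]]; first by rewrite muln0 addn0.
      by have -> : (N + 2 * j.+1 = (N + 2 * j).+2)%N by lia.
    exact.
  have [a1 a2] := alt _ hk; have [a3 a4] := alt _ k0; split=> //.
  rewrite -natr1; have := hu (N + 2 * k)%N; have := hu (N + 2 * k).+1.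
  have := hu (N + 2 * k).+2.
  move: hk a1 a2 a3 a4 kl.
  move: (u (N + 2 * k)%N) (u (N + 2 * k).+1) (u (N + 2 * k).+2)
    (u (N + 2 * k).+3) (u (N + 2 * k).+4) => v0 v1 v2 v3 v4.
  move=> *.
  have : v3 <= c by nra.
  have v2l : v2 < -1 by nra.
  by nra.
have [k hk] := nat_ltr (- u N.+2 * 2).
have [] := low k; lra.
Qed.

(** * Convergence to periodic solutions along even periods *)

Lemma ev_nondecreasing_cvgn (R : realType) (s : nat -> R) (M : R) (N : nat) :
  (forall k, `|s k| <= M) -> (forall k, (N <= k)%N -> s k <= s k.+1) -> cvgn s.
Proof.
move=> sM sN.
suff: cvgn (fun n => s (n + N)%N).
  by move=> /cvg_ex[l]; rewrite (cvg_shiftn N) => sl; apply/cvg_ex; exists l.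
apply: nondecreasing_is_cvgn.
  by apply/nondecreasing_seqP => n; rewrite addSn sN// leq_addl.
by exists M => _ [n _ <-]; exact: le_trans (ler_norm _) (sM _).
Qed.

Lemma ev_nonincreasing_cvgn (R : realType) (s : nat -> R) (M : R) (N : nat) :
  (forall k, `|s k| <= M) -> (forall k, (N <= k)%N -> s k.+1 <= s k) -> cvgn s.
Proof.
move=> sM sN; rewrite -is_cvgNE; apply: (@ev_nondecreasing_cvgn _ _ M N) => k.
  by rewrite fctE normrN.
by move=> Nk; rewrite !fctE lerN2 sN.
Qed.

(* The differences [D n = t (n + m) - t n] satisfy
   [D (n + 2) = t (n + m + 1) * D n + t n * D (n + 1)]: two consecutive ones of
   the same sign fix the sign forever, otherwise the signs alternate, and then
   they are constant along steps of the even length [m]. *)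
Lemma subseq_cvgn (R : realType) (t k : nat -> R) (m : nat) (M : R) :
  ~~ odd m -> (forall n, 0 <= t n) -> (forall n, t n <= M) ->
  (forall n, t n.+2 = t n.+1 * t n + k n) ->
  (forall n, k (n + m)%N = k n) ->
  forall n, cvgn (fun j => t (n + j * m)%N).
Proof.
move=> m2 t0 tM ht km n.
pose D i := t (i + m)%N - t i.
have DS i : D i.+2 = t (i + m).+1 * D i + t i * D i.+1.
  by rewrite /D !addSn !ht km; ring.
have DE j : t (n + j.+1 * m)%N - t (n + j * m)%N = D (n + j * m)%N.
  by rewrite /D mulSn -addnA (addnC (j * m)%N).
have tM' j : `|t (n + j * m)%N| <= M by rewrite ger0_norm.
have [->|m0] := eqVneq m 0%N.
  under eq_fun do rewrite muln0 addn0.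
  exact: is_cvg_cst.
have far N j : (N <= j)%N -> (N <= n + j * m)%N.
  by move=> Nj; rewrite (leq_trans Nj)// (leq_trans _ (leq_addl _ _))// leq_pmulr// lt0n.
have [[N [N0 N1]]|Hpos] := pselect (exists N, 0 <= D N /\ 0 <= D N.+1).
  apply: (@ev_nondecreasing_cvgn _ _ M N) => // j /far Nj.
  rewrite -subr_ge0 DE -(subnKC Nj); move: (n + j * m - N)%N.
  apply: nat_ind2 => [||i i0]; rewrite ?addn0 ?addn1// !addnS => i1.
  by rewrite DS; apply: addr_ge0; apply: mulr_ge0.
have [[N [N0 N1]]|Hneg] := pselect (exists N, D N <= 0 /\ D N.+1 <= 0).
  apply: (@ev_nonincreasing_cvgn _ _ M N) => // j /far Nj.
  rewrite -subr_le0 DE -(subnKC Nj); move: (n + j * m - N)%N.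
  apply: nat_ind2 => [||i i0]; rewrite ?addn0 ?addn1// !addnS => i1.
  by rewrite DS -oppr_ge0 opprD -!mulrN; apply: addr_ge0; apply: mulr_ge0; rewrite ?oppr_ge0.
have mE j : (n + j * m = n + (j * m./2).*2)%N.
  by rewrite doubleMr even_halfK.
have [D0|D0] := leP 0 (D n).
  apply: (@ev_nondecreasing_cvgn _ _ M 0) => // j _.
  rewrite -subr_ge0 DE mE; elim: (j * m./2)%N => [|i i0]; first by rewrite addn0.
  rewrite doubleS !addnS leNgt; apply/negP => i2.
  have [i1|i1] := leP 0 (D (n + i.*2).+1); first by apply: Hpos; exists (n + i.*2)%N.
  by apply: Hneg; exists (n + i.*2).+1; rewrite !ltW.
apply: (@ev_nonincreasing_cvgn _ _ M 0) => // j _.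
rewrite -subr_le0 DE mE; elim: (j * m./2)%N => [|i i0]; first by rewrite addn0 ltW.
rewrite doubleS !addnS leNgt; apply/negP => i2.
have [i1|i1] := leP (D (n + i.*2).+1) 0; first by apply: Hneg; exists (n + i.*2)%N.
by apply: Hpos; exists (n + i.*2).+1; rewrite !ltW.
Qed.

Lemma cvgn_to_periodic (R : realType) (t L : nat -> R) (m : nat) :
  (0 < m)%N -> (forall n, L (n + m)%N = L n) ->
  (forall n, t (n + j * m)%N @[j --> \oo] --> L n) ->
  (fun n => t n - L n) @ \oo --> 0.
Proof.
move=> m0 Lm tL; apply/cvgr0Pnorm_lt => e e0.
have /choice[K HK] r : exists K, forall j, (K <= j)%N -> `|L r - t (r + j * m)%N| < e.
  by have /cvgrPdist_lt/(_ _ e0)[K _ HK] := tL r; exists K.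
(* From this index on, [n %/ m] is at least the threshold [K r] of every residue class [r]. *)
exists ((\max_(r < m) K r) * m)%N => // n /= Nn.
have Lq q r : L (r + q * m)%N = L r.
  by elim: q => [|q IH]; rewrite ?addn0// mulSn (addnC m) addnA Lm.
rewrite distrC {2}(divn_eq n m) {1}(divn_eq n m) addnC Lq; apply: HK.
have rm : (n %% m < m)%N by rewrite ltn_mod.
rewrite leq_divRL// (leq_trans _ Nn)// leq_mul2r.
by rewrite (leq_bigmax (Ordinal rm)) orbT.
Qed.

(** Since [k] is constant along each residue class modulo [m], the recurrence passes to the limits
    along these classes. *)
Lemma periodic_limit (R : realType) (t k : nat -> R) (m : nat) (M : R) :
  (0 < m)%N -> ~~ odd m -> (forall n, 0 <= t n) -> (forall n, t n <= M) ->
  (forall n, t n.+2 = t n.+1 * t n + k n) ->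
  (forall n, k (n + m)%N = k n) ->
  exists L : nat -> R,
    [/\ forall n, 0 <= L n, forall n, L (n + m)%N = L n,
        forall n, L n.+2 = L n.+1 * L n + k n
      & (fun n => t n - L n) @ \oo --> 0].
Proof.
move=> m0 m2 t0 tM ht km.
have tc := subseq_cvgn m2 t0 tM ht km.
pose L n := limn (fun j => t (n + j * m)%N).
have tL n : t (n + j * m)%N @[j --> \oo] --> L n := tc n.
have kj n j : k (n + j * m)%N = k n.
  by elim: j => [|j IH]; rewrite ?addn0// mulSn (addnC m) addnA km.
have Lm n : L (n + m)%N = L n.
  apply: (cvg_unique _ (tL _)) => //; have := tL n; rewrite -cvg_shiftS.
  by under eq_fun do rewrite mulSn addnA.
exists L; split=> //.
- move=> n; apply: limr_ge; first exact: tc.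
  by apply: nearW.
- move=> n; apply: (cvg_unique _ (tL _)) => //.
  have -> : (fun j => t (n.+2 + j * m)%N) =
      (fun j => t (n.+1 + j * m)%N * t (n + j * m)%N + k n).
    by apply/funext => j; rewrite !addSn ht kj.
  by apply: cvgD; [apply: cvgM; exact: tL|exact: cvg_cst].
- exact: cvgn_to_periodic tL.
Qed.

(** * Limits of bounded orbits: fixed points and the 3-cycle *)

Lemma fixpoints (R : realType) (c : R) : 0 < c -> c < 1 / 4 ->
  [/\ 0 < a1 c, a1 c < 1 / 2, 1 / 2 < a2 c,
      a1 c * a1 c + c = a1 c & a2 c * a2 c + c = a2 c].
Proof.
move=> c0 c1; rewrite /a1 /a2.
have d0 : 0 < 1 - 4 * c by lra.
have := sqr_sqrtr (ltW d0); have : 0 < Num.sqrt (1 - 4 * c) by rewrite sqrtr_gt0.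
rewrite expr2; move: (Num.sqrt _) => s s0 sE.
split; [nra|lra|lra|lra|lra].
Qed.

Lemma fixpointP (R : realType) (c l : R) : 0 < c -> c < 1 / 4 ->
  l * l + c = l -> l = a1 c \/ l = a2 c.
Proof.
move=> c0 c1 lE; have [_ _ _ e1 e2] := fixpoints c0 c1.
have : (l - a1 c) * (l - a2 c) = 0.
  have -> : a2 c = 1 - a1 c by rewrite /a1 /a2; field.
  lra.
by move/eqP; rewrite mulf_eq0 !subr_eq0 => /orP[] /eqP; [left|right].
Qed.

Lemma nonneg_orbit_cvg (R : realType) (c : R) (u : nat -> R) (M : R) :
  0 < c -> c < 1 / 4 -> (forall n, u n.+2 = u n.+1 * u n + c) ->
  (forall n, 0 <= u n) -> (forall n, u n <= M) ->
  exists2 l, l = a1 c \/ l = a2 c & (fun n => u n - l) @ \oo --> 0.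
Proof.
move=> c0 c1 hu u0 uM.
have [L [L0 L2 hL uL]] := @periodic_limit _ u (fun=> c) 2 M isT isT u0 uM hu (fun=> erefl).
(* By 2-periodicity both values equal their product plus c. *)
have L10 : L 1%N = L 0%N.
  by have := hL 0%N; have := hL 1%N; rewrite -[2%N]/(0 + 2)%N -[3%N]/(1 + 2)%N !L2; lra.
have LE n : L n = L 0%N by elim/nat_ind2: n => // n Ln _; rewrite -addn2 L2.
exists (L 0%N); first by apply: fixpointP => //; have := hL 0%N; rewrite !LE.
by move: uL; under eq_fun do rewrite LE.
Qed.

(* If [b < b'] and [a' < a], the equations give
   [a' * b' * (b' + c) * (a + c) = a * b * (b + c) * (a' + c)],
   hence [a' * b' < a * b] and [s' < s]; but then
   [a + c = b * s' < b' * s = a' + c]. *)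
Lemma six_cycle_half (R : realType) (c a b s a' b' s' : R) :
  0 < c -> 0 < a -> 0 < b -> 0 < s -> 0 < a' -> 0 < b' -> 0 < s' ->
  s = a * b + c -> b' + c = s * a -> a' + c = b' * s ->
  s' = a' * b' + c -> b + c = s' * a' -> a + c = b * s' ->
  b < b' -> a <= a'.
Proof.
move=> c0 a0 b0 s0 a'0 b'0 s'0 es eb' ea' es' eb ea bb'.
rewrite leNgt; apply/negP => aa'.
have [ss|ss] := leP s s'; last first.
  have : b * s' < b' * s by apply: ltr_pM => //; lra.
  lra.
have E : (a' * b') * ((b' + c) * (a + c)) = (a * b) * ((b + c) * (a' + c)).
  by rewrite eb' ea' eb ea; ring.
have : (a * b) * ((b + c) * (a' + c)) < (a' * b') * ((b' + c) * (a + c)).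
  have h1 : (b + c) * (a' + c) < (b' + c) * (a + c) by apply: ltr_pM; lra.
  have h2 : a * b <= a' * b' by lra.
  apply: lt_le_trans (_ : (a * b) * ((b' + c) * (a + c)) <= _).
    by rewrite ltr_pM2l// mulr_gt0.
  by rewrite ler_wpM2r// mulr_ge0; lra.
by rewrite E ltxx.
Qed.

(** If b < b', then a <= a' by [six_cycle_half], so s <= s', and b' + c = s a <= s' a' = b + c is a
    contradiction. *)
Lemma six_cycle_le (R : realType) (c a b s a' b' s' : R) :
  0 < c -> 0 < a -> 0 < b -> 0 < s -> 0 < a' -> 0 < b' -> 0 < s' ->
  s = a * b + c -> b' + c = s * a -> a' + c = b' * s ->
  s' = a' * b' + c -> b + c = s' * a' -> a + c = b * s' ->
  b' <= b.
Proof.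
move=> c0 a0 b0 s0 a'0 b'0 s'0 es eb' ea' es' eb ea.
rewrite leNgt; apply/negP => bb'.
have aa' : a <= a' by exact: (six_cycle_half c0 a0 b0 s0 a'0 b'0 s'0).
have : a * b <= a' * b' by apply: ler_pM; lra.
move=> h; have : s * a <= s' * a' by apply: ler_pM; lra.
lra.
Qed.

(** Two turns of the pattern [-,-,+] in absolute values, in the order b, a, s, b', a', s'. Applying
    [six_cycle_le] both ways gives b = b', then a = a' and s = s'; the difference of the equations
    for a and b gives a = b, and (a - 1)(a^2 + a + c) = 0 remains. *)
Lemma six_cycle (R : realType) (c a b s a' b' s' : R) :
  0 < c -> 0 <= a -> 0 <= b -> 0 <= s -> 0 <= a' -> 0 <= b' -> 0 <= s' ->
  s = a * b + c -> b' = s * a - c -> a' = b' * s - c ->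
  s' = a' * b' + c -> b = s' * a' - c -> a = b * s' - c ->
  [/\ [/\ b = 1, a = 1 & s = 1 + c] & [/\ b' = 1, a' = 1 & s' = 1 + c]].
Proof.
move=> c0 a0 b0 s0 a'0 b'0 s'0 es eb' ea' es' eb ea.
(* A vanishing unknown would make a later one equal to -c < 0. *)
have pos (x y z : R) : 0 <= x -> 0 <= z -> z = y * x - c -> 0 < x.
  move=> x0 z0 zE; rewrite lt_neqAle x0 andbT; apply/eqP => xE.
  by move: z0; rewrite zE -xE mulr0; lra.
have a1 : 0 < a by apply: (pos a s b').
have b1 : 0 < b by apply: (pos b s' a) => //; rewrite mulrC.
have a'1 : 0 < a' by apply: (pos a' s' b).
have b'1 : 0 < b' by apply: (pos b' s a') => //; rewrite mulrC.
move: {a0 b0 a'0 b'0} a1 b1 a'1 b'1 => a0 b0 a'0 b'0.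
have {}s0 : 0 < s by rewrite es; nra.
have {}s'0 : 0 < s' by rewrite es'; nra.
have bb' : b = b'.
  apply/eqP; rewrite eq_le; apply/andP; split.
    by apply: (@six_cycle_le _ c a' b' s' a b s) => //; lra.
  by apply: (@six_cycle_le _ c a b s a' b' s') => //; lra.
rewrite -{}bb' {b'0} in eb' ea' es' *.
have aa' : a = a'.
  have [h|h|//] := ltgtP a a'.
    have : a * b < a' * b by rewrite ltr_pM2r.
    move=> h1; have : s * a < s' * a' by apply: ltr_pM; lra.
    lra.
  have : a' * b < a * b by rewrite ltr_pM2r.
  move=> h1; have : s' * a' < s * a by apply: ltr_pM; lra.
  lra.
have ss' : s = s' by rewrite es es' aa'.
have ab : a = b.
  have : (a - b) * (1 + s) = 0 by lra.
  by move/eqP; rewrite mulf_eq0 subr_eq0 => /orP[/eqP//|/eqP]; lra.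
have a1 : a = 1.
  have : (a - 1) * (a * a + a + c) = 0.
    by move: eb'; rewrite es -ab; lra.
  by move/eqP; rewrite mulf_eq0 subr_eq0 => /orP[/eqP//|/eqP]; nra.
by rewrite -aa' -ss' -ab es -ab a1 mulr1.
Qed.

(** The orbit of [p3] in the second coordinate, see [orb_p3]. *)
Definition per3 (R : realType) (c : R) (n : nat) : R :=
  if (n %% 3 == 2)%N then 1 + c else -1.

(** The constants have period 3, but monotonicity needs an even period, so the limit is first
    obtained with period 6; [six_cycle] reduces it to the 3-cycle. *)
Lemma pattern_orbit_cvg (R : realType) (c : R) (u : nat -> R) (M : R) :
  0 < c -> (forall n, u n.+2 = u n.+1 * u n + c) ->
  (forall n, 0 <= pat3 R n * u n) -> (forall n, `|u n| <= M) ->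
  (fun n => u n - per3 c n) @ \oo --> 0.
Proof.
move=> c0 hu u0 uM.
pose t n := pat3 R n * u n.
have tM n : t n <= M.
  by rewrite (le_trans _ (uM n))// (le_trans (ler_norm _))// normrM (twist_pat3 R n).1 mul1r.
have m6 n : ((n + 6) %% 3 = n %% 3)%N by lia.
have p6 n : pat3 R (n + 6) = pat3 R n by rewrite /pat3 m6.
have ht := twist_rec (@twist_pat3 R) hu.
have [|L [L0 L6 hL tL]] :=
  @periodic_limit _ t (fun n => pat3 R n.+2 * c) 6 M isT isT u0 tM ht.
  by move=> n; rewrite -!addSn p6.
have LE n : pat3 R n * L n = per3 c n.
  have := hL 0%N; have := hL 1%N; have := hL 2%N; have := hL 3%N.
  have := hL 4%N; have := hL 5%N; rewrite /pat3 /=.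
  rewrite -[6%N]/(0 + 6)%N -[7%N]/(1 + 6)%N !L6 !mul1r !mulN1r => e0 e1 e2 e3 e4 e5.
  have [[b1 a1 s1] [b2 a2 s2]] :=
    six_cycle c0 (L0 1%N) (L0 0%N) (L0 2%N) (L0 4%N) (L0 3%N) (L0 5%N) e5 e4 e3 e2 e1 e0.
  have -> : L n = if (n %% 3 == 2)%N then 1 + c else 1.
    elim/ltn_ind: n => n IH; have [n6|n6] := ltnP n 6.
      by case: n n6 {IH} => [|[|[|[|[|[|]]]]]].
    by rewrite -(subnK n6) L6 m6 IH//; lia.
  by rewrite /per3; case: ifP => _; rewrite ?mul1r ?mulr1.
have -> : (fun n => u n - per3 c n) = (fun n => pat3 R n * (t n - L n)).
  apply/funext => n; rewrite mulrBr LE /t mulrA twist_sqr ?mul1r//.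
  exact: twist_pat3.
apply/norm_cvg0P; under eq_fun do rewrite normrM (twist_pat3 R _).1 mul1r.
exact/norm_cvg0P.
Qed.

(** * Orbits as scalar sequences; [Kplus] and [Ws] in terms of them *)

Definition orb (R : realType) (c : R) (z : R * R) (n : nat) : R :=
  (iter n (planemap c) z).2.

Lemma orbE (R : realType) (c : R) (z : R * R) (n : nat) :
  iter n (planemap c) z = (orb c z n.+1, orb c z n).
Proof. by rewrite /orb iterS /=; case: (iter _ _ _). Qed.

Lemma orb_rec (R : realType) (c : R) (z : R * R) (n : nat) :
  orb c z n.+2 = orb c z n.+1 * orb c z n + c.
Proof. by []. Qed.

Lemma orb_iter (R : realType) (c : R) (z : R * R) (N n : nat) :
  orb c (iter N (planemap c) z) n = orb c z (N + n).
Proof. by rewrite /orb addnC iterD. Qed.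

Lemma KplusP (R : realType) (c : R) (z : R * R) :
  Kplus c z <-> exists M : R, forall n, `|orb c z n| <= M.
Proof.
have FF : ProperFilter (globally [set: nat]).
  by apply: (@globally_properfilter _ _ 0%N).
rewrite /Kplus /=; split.
  move=> /ex_bound[M /= HM]; exists M => n.
  by rewrite (le_trans _ (HM n I))// orbE prod_normE le_max lexx orbT.
move=> [M HM]; apply/ex_bound; exists M => n /= _.
by rewrite orbE prod_normE ge_max !HM.
Qed.

Lemma Kplus_iter (R : realType) (c : R) (z : R * R) (N : nat) :
  Kplus c (iter N (planemap c) z) <-> Kplus c z.
Proof.
split=> /KplusP[M HM]; apply/KplusP; last first.
  by exists M => n; rewrite orb_iter.
exists (M + \sum_(i < N) `|orb c z i|) => n.
have S0 : 0 <= \sum_(i < N) `|orb c z i| by apply: sumr_ge0.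
have [nN|Nn] := ltnP n N; last first.
  by rewrite -(subnKC Nn) -orb_iter (le_trans (HM _))// lerDl.
apply: (@le_trans _ _ (\sum_(i < N) `|orb c z i|)); last first.
  by rewrite lerDr (le_trans _ (HM 0%N)).
by rewrite (bigD1 (Ordinal nN))//= lerDl sumr_ge0.
Qed.

Lemma WsP (R : realType) (c : R) (q z : R * R) :
  Ws c q z <-> (fun n => orb c z n - orb c q n) @ \oo --> 0.
Proof.
rewrite /Ws /=; split=> h.
  apply/cvgr0Pnorm_lt => e e0; move: h => /cvgr0Pnorm_lt/(_ _ e0).
  apply: filterS => n; rewrite normr_id; apply: le_lt_trans.
  by rewrite !orbE prod_normE le_max lexx orbT.
have h1 := h; rewrite -cvg_shiftS in h1.
apply/cvgr0Pnorm_lt => e e0.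
move: h h1 => /cvgr0Pnorm_lt/(_ _ e0) h /cvgr0Pnorm_lt/(_ _ e0) h1.
by apply: filterS2 h h1 => n h h1; rewrite normr_id !orbE prod_normE gt_max h1.
Qed.

Lemma Ws_iter (R : realType) (c : R) (q z : R * R) (N : nat) :
  Ws c (iter N (planemap c) q) (iter N (planemap c) z) <-> Ws c q z.
Proof.
have -> : Ws c q z <-> (fun n => orb c z n - orb c q n) @ \oo --> 0 := WsP c q z.
rewrite -(cvg_shiftn N); split=> [/WsP|h]; last apply/WsP.
  by under eq_fun do rewrite !orb_iter !(addnC N).
by under eq_fun do rewrite !orb_iter !(addnC N).
Qed.

Lemma orb_fix (R : realType) (c a : R) (n : nat) :
  a * a + c = a -> orb c (a, a) n = a.
Proof.
by move=> aE; elim/nat_ind2: n => // n h h1; rewrite orb_rec h h1.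
Qed.

Lemma orb_p3 (R : realType) (c : R) (n : nat) : orb c (p3 R) n = per3 c n.
Proof.
elim/nat_ind2: n => // n h h1; rewrite orb_rec h h1 /per3 (divn_eq n 3) -!addnS !modnMDl.
have : (n %% 3 < 3)%N by rewrite ltn_mod.
by case: (n %% 3)%N => [|[|[|]]] //= _; ring.
Qed.

Lemma p3_iter3 (R : realType) (c : R) (k : nat) :
  iter (k * 3) (planemap c) (p3 R) = p3 R.
Proof.
by rewrite orbE !orb_p3 /per3 -addn1 modnMDl modnMl.
Qed.

Lemma bounded_Ws (R : realType) (c : R) (z : R * R) : 0 < c -> c < 1 / 4 ->
  Kplus c z ->
  [\/ Ws c (alpha c) z, Ws c (theta c) z |
      exists2 j, (j < 3)%N & Ws c (iter j (planemap c) (p3 R)) z].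
Proof.
move=> c0 c1 /KplusP[M HM].
have [_ _ _ e1 e2] := fixpoints c0 c1.
have [N [uN|uN]] := sign_dichotomy c0 c1 (orb_rec c z).
  have [|||l [] -> ul] := @nonneg_orbit_cvg _ c (orb c (iter N (planemap c) z)) M c0 c1.
  - exact: orb_rec.
  - by move=> n; rewrite orb_iter.
  - by move=> n; rewrite orb_iter (le_trans (ler_norm _)).
  - apply: Or31; apply/WsP; rewrite -(cvg_shiftn N) /alpha.
    by under eq_fun do rewrite (orb_fix _ e1) addnC -orb_iter.
  - apply: Or32; apply/WsP; rewrite -(cvg_shiftn N) /theta.
    by under eq_fun do rewrite (orb_fix _ e2) addnC -orb_iter.
(* This exponent is -N modulo 3: [N] more steps lead back to [p3], in phase with the pattern
   starting at [N]. *)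
apply: Or33; exists ((2 * N) %% 3)%N; first by rewrite ltn_mod.
apply/(Ws_iter _ _ _ N); rewrite -iterD.
have -> : iter (N + (2 * N) %% 3) (planemap c) (p3 R) = p3 R.
  rewrite -[RHS](p3_iter3 c (N - (2 * N) %/ 3)) ; congr iter.
  by have := divn_eq (2 * N) 3; lia.
apply/WsP; under eq_fun do rewrite orb_p3.
apply: (@pattern_orbit_cvg _ c _ M) => // n; rewrite orb_iter//.
exact/ltW.
Qed.

Lemma cvg_sub0_bounded (R : realType) (u v : nat -> R) (M : R) :
  (fun n => u n - v n) @ \oo --> 0 -> (forall n, `|v n| <= M) ->
  exists N, forall n, `|u (N + n)%N| <= M + 1.
Proof.
move=> /cvgr0Pnorm_lt/(_ 1 ltr01)[N _ HN] vM; exists N => n.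
rewrite -(subrK (v (N + n)%N) (u _)) addrC (le_trans (ler_normD _ _))// lerD//.
by apply/ltW/HN; rewrite /= leq_addr.
Qed.

Lemma Ws_Kplus (R : realType) (c : R) (q z : R * R) :
  Kplus c q -> Ws c q z -> Kplus c z.
Proof.
move=> /KplusP[M qM] /WsP/cvg_sub0_bounded/(_ qM)[N HN].
by apply/(Kplus_iter _ _ N)/KplusP; exists (M + 1) => n; rewrite orb_iter.
Qed.

(** * Escape of unbounded orbits and closedness of [Kplus] *)

(** A term preceded by one of size at least c is bounded by a multiple of 1/c, as otherwise it and
    its successor would both exceed 2 in absolute value. The recurrence then bounds the remaining
    terms. *)
Lemma orbit_eventually_large (R : realType) (c : R) (u : nat -> R) :
  0 < c -> c < 1 / 4 -> (forall n, u n.+2 = u n.+1 * u n + c) ->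
  (forall n, ~ (2 < `|u n| /\ 2 < `|u n.+1|)) ->
  exists N M, forall n, `|u (N + n)%N| <= M.
Proof.
move=> c0 c1 hu Hn.
have ic : c * c^-1 = 1 by rewrite mulfV// gt_eqF.
have ic4 : 4 < c^-1 by have := invr_gt0 c; rewrite c0; nra.
have [N [uN|uN]] := sign_dichotomy c0 c1 hu.
  exists (N + 3)%N, (3 * c^-1) => n; rewrite -addnA ger0_norm//.
  have -> : (N + (3 + n) = (N + n).+3)%N by lia.
  rewrite leNgt; apply/negP => u3; apply: (Hn (N + n).+3).
  have := hu (N + n).+2; have := hu (N + n)%N; have := uN n; have := uN n.+1.
  rewrite !addnS; move=> p1 p0 e2 e4.
  have ? : c <= u (N + n).+2 by rewrite e2 lerDr mulr_ge0.
  have ? : 3 <= u (N + n).+4 by rewrite e4; nra.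
  by rewrite !ger0_norm; lra.
pose v n := `|u (N + n)%N|.
have v0 n : 0 < v n by rewrite normr_gt0; apply/eqP => h; have := uN n; rewrite h mulr0 ltxx.
have vE n : v n = pat3 R n * u (N + n)%N.
  by rewrite -[RHS]ger0_norm ?ltW// normrM (twist_pat3 R n).1 mul1r.
have hv n : v n.+2 = v n.+1 * v n + pat3 R n.+2 * c.
  rewrite !vE; have := twist_rec (@twist_pat3 R) (u := fun n => u (N + n)%N) _ n.
  by apply=> k; rewrite !addnS.
have Hv n : ~ (2 < v n /\ 2 < v n.+1) by rewrite /v addnS; exact: Hn.
have pE k : [/\ pat3 R (3 * k) = -1, pat3 R (3 * k).+1 = -1, pat3 R (3 * k).+2 = 1,
    pat3 R (3 * k).+3 = -1 & pat3 R (3 * k).+4 = -1].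
  have pm j : pat3 R (3 * k + j) = pat3 R j by rewrite /pat3 mulnC modnMDl.
  have := pm 4%N; have := pm 3%N; have := pm 2%N; have := pm 1%N; have := pm 0%N.
  by rewrite addn0 addn1 addn2 addn3 addn4 => -> -> -> -> ->.
have vs k : c < v (3 * k).+2.
  by rewrite hv; have [_ _ -> _ _] := pE k; rewrite mul1r ltrDr mulr_gt0.
have vb k : v (3 * k).+3 <= 4 * c^-1.
  rewrite leNgt; apply/negP => h; apply: (Hv (3 * k).+3).
  have := hv (3 * k).+2; have [_ _ _ _ ->] := pE k; have := vs k; nra.
(* Read backwards: [v (3 * k).+4] times the next term, which exceeds c, is the following term plus
   c, hence at most 4/c + c. *)
have va k : v (3 * k).+4 <= 4 * c^-1 * c^-1 + 1.
  have := vb k.+1; have := vs k.+1; have [_ _ _ p _] := pE k.+1.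
  have := hv (3 * k.+1).+1; rewrite p.
  have -> : (3 * k.+1 = (3 * k).+3)%N by lia.
  have := v0 (3 * k).+4; move: (v (3 * k).+4) (v (3 * k).+3.+2) (v (3 * k).+3.+3) => x w y x0 -> ? ?.
  rewrite leNgt; apply/negP => h; have : c * x <= w * x by rewrite ler_pM2r ?ltW.
  have : c * (4 * c^-1 * c^-1 + 1) < c * x by rewrite ltr_pM2l.
  have -> : c * (4 * c^-1 * c^-1 + 1) = 4 * c^-1 * (c * c^-1) + c by ring.
  rewrite ic; lra.
pose A := 4 * c^-1; pose B := 4 * c^-1 * c^-1 + 1.
have A0 : 0 < A by rewrite /A; lra.
have B0 : 0 < B by rewrite /B; nra.
have vs' k : v (3 * k).+4.+1 <= B * A + c.
  have [_ _ p _ _] := pE k.+1; rewrite (_ : 3 * k.+1 = (3 * k).+3)%N in p; last by lia.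
  by rewrite hv p mul1r lerD2r; apply: ler_pM; [exact/ltW|exact/ltW|exact: va|exact: vb].
exists (N + 3)%N, (A + B + B * A + c) => n.
rewrite -addnA -/(v _) (_ : 3 + n = 3 * (n %/ 3) + (n %% 3 + 3))%N; last first.
  by rewrite {1}(divn_eq n 3); lia.
have : (n %% 3 < 3)%N by rewrite ltn_mod.
have := mulr_gt0 B0 A0.
case: (n %% 3)%N => [|[|[|]]] //= h _; rewrite ?add0n ?addSn ?addnS ?addn0.
- by have := vb (n %/ 3)%N; rewrite -/A; lra.
- by have := va (n %/ 3)%N; rewrite -/B; lra.
- by have := vs' (n %/ 3)%N; lra.
Qed.

(** With |u(n)| > 2, |u(n+2)| >= |u(n+1)| |u(n)| - c > 2 |u(n+1)| - c, so the absolute values gain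
    more than 1/2 at each step. *)
Lemma large_unbounded (R : realType) (c : R) (z : R * R) (n : nat) :
  0 < c -> c < 1 / 4 -> 2 < `|orb c z n| -> 2 < `|orb c z n.+1| -> ~ Kplus c z.
Proof.
move=> c0 c1 h h1 /KplusP[M HM].
have H k : 2 < `|orb c z (n + k)| /\ 2 + k%:R / 2 < `|orb c z (n + k).+1|.
  elim: k => [|k [k0 k1]]; first by rewrite addn0 mul0r addr0.
  rewrite addnS; have kp : 0 <= k%:R :> R by [].
  split; first lra.
  have := lerB_normD (orb c z (n + k).+1 * orb c z (n + k)) c.
  rewrite orb_rec normrM (gtr0_norm c0) -(natr1 k).
  move: k0 k1; set x := `|orb _ _ _|; set y := `|orb _ _ _| => k0 k1.
  have : 0 < y * (x - 2) by apply: mulr_gt0; lra.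
  lra.
have [k hk] := nat_ltr (M * 2).
have := HM (n + k).+1; have [_] := H k; lra.
Qed.

Lemma fst_continuous (R : realType) : continuous (fst : R * R -> R).
Proof. by move=> z; exact: (@cvg_fst _ _ (nbhs z.1) (nbhs z.2) _). Qed.

Lemma snd_continuous (R : realType) : continuous (snd : R * R -> R).
Proof. by move=> z; exact: (@cvg_snd _ _ (nbhs z.1) (nbhs z.2) _). Qed.

Lemma cvg_plane (T : Type) (R : realType) (F : set_system T) (f g : T -> R) (a b : R) :
  Filter F -> f x @[x --> F] --> a -> g x @[x --> F] --> b ->
  (f x, g x) @[x --> F] --> (a, b).
Proof. by move=> FF; exact: (@cvg_pair _ _ _ F (nbhs a) (nbhs b)). Qed.

Lemma planemap_continuous (R : realType) (c : R) : continuous (planemap c).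
Proof.
move=> z; apply: cvg_plane; last exact: fst_continuous.
apply: cvgD; last exact: cvg_cst.
by apply: cvgM; [exact: fst_continuous|exact: snd_continuous].
Qed.

Lemma orb_continuous (R : realType) (c : R) (n : nat) :
  continuous (fun z => orb c z n).
Proof.
have H : continuous (iter n (planemap c)).
  elim: n => [|n IH] z; first exact: cvg_id.
  by rewrite /=; apply: (@continuous_comp _ _ _ _ (planemap c)); [exact: IH|exact: planemap_continuous].
by move=> z; apply: (@continuous_comp _ _ _ _ snd); [exact: H|exact: snd_continuous].
Qed.

Lemma Kplus_closed (R : realType) (c : R) : 0 < c -> c < 1 / 4 -> closed (Kplus c).
Proof.
move=> c0 c1; rewrite -openC.
have -> : ~` Kplus c = \bigcup_n
    ((fun z => `|orb c z n|) @^-1` [set x | 2 < x] `&`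
     (fun z => `|orb c z n.+1|) @^-1` [set x | 2 < x]).
  apply/seteqP; split=> [z nz|z [n _ [h h1]]] /=; last exact: (large_unbounded c0 c1 h h1).
  apply: contrapT => Hz; apply: nz.
  have [|N [M HM]] := orbit_eventually_large c0 c1 (orb_rec c z).
    by move=> n [h h1]; apply: Hz; exists n.
  by apply/(Kplus_iter _ _ N)/KplusP; exists M => n; rewrite orb_iter.
apply: bigcup_open => n _; apply: openI; apply: open_comp; try exact: open_gt;
  by move=> z _; apply: cvg_norm; exact: orb_continuous.
Qed.

(** * The basin of [alpha] lies in the interior *)

(** The product of two such terms is below 1/4 in absolute value, and 1/4 + c < 1/2. *)
Lemma orb_small (R : realType) (c : R) (z : R * R) (n : nat) :
  0 < c -> c < 1 / 4 -> `|orb c z n| < 1 / 2 -> `|orb c z n.+1| < 1 / 2 ->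
  forall k, `|orb c z (n + k)| < 1 / 2.
Proof.
move=> c0 c1 h h1; apply: nat_ind2 => [||k k0 k1]; rewrite ?addn0 ?addn1//.
rewrite !addnS in k1 *; rewrite orb_rec (le_lt_trans (ler_normD _ _))//.
rewrite normrM (gtr0_norm c0).
move: k0 k1 (normr_ge0 (orb c z (n + k))) (normr_ge0 (orb c z (n + k).+1)).
move: `|_| `|_| => x y *; nra.
Qed.

Lemma Ws_alpha_interior (R : realType) (c : R) : 0 < c -> c < 1 / 4 ->
  Ws c (alpha c) `<=` interior (Kplus c).
Proof.
move=> c0 c1; have [a0 a1 _ aE _] := fixpoints c0 c1.
(* The points whose orbit enters the invariant square. *)
pose U := \bigcup_n
    ((fun z => `|orb c z n|) @^-1` [set x | x < 1 / 2] `&`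
     (fun z => `|orb c z n.+1|) @^-1` [set x | x < 1 / 2]).
have Uo : open U.
  apply: bigcup_open => n _; apply: openI; apply: open_comp; try exact: open_lt;
    by move=> z _; apply: cvg_norm; exact: orb_continuous.
have UK : U `<=` Kplus c.
  move=> z [n _ /= [h h1]]; apply/(Kplus_iter _ _ n)/KplusP; exists (1 / 2) => k.
  by rewrite orb_iter ltW// orb_small.
move=> z /WsP; rewrite /alpha; under eq_fun do rewrite (orb_fix _ aE).
have e0 : 0 < 1 / 2 - Defs.a1 c by lra.
move=> /cvgr0Pnorm_lt/(_ _ e0)[N _ HN].
have : U `<=` interior (Kplus c) by rewrite -open_subsetE.
apply; exists N => //=.
by split; [have := HN N (leqnn N)|have := HN N.+1 (leqnSn N)];
  rewrite /= !ltr_norml => /andP[? ?]; lra.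
Qed.

(** * Expanding orbits avoid the interior *)

(** The inverse [g] is continuous at the image of [z], whose second coordinate is [z.1]; points near
    the image therefore have preimages in [Kplus], and so lie in it themselves. *)
Lemma planemap_interior (R : realType) (c : R) (z : R * R) :
  z.1 != 0 -> interior (Kplus c) z -> interior (Kplus c) (planemap c z).
Proof.
move=> z0 Kz.
pose g (w : R * R) := (w.2, (w.1 - c) / w.2).
have gz : g w @[w --> planemap c z] --> z.
  have -> : nbhs z = nbhs (z.1, (z.1 * z.2 + c - c) / z.1).
    by rewrite addrK mulrC mulKf//; case: (z).
  have sc := @snd_continuous R (planemap c z).
  apply: cvg_plane => //; apply: cvgM; last exact: cvgV.
  by apply: cvgB; [exact: (@fst_continuous R (planemap c z))|exact: cvg_cst].
have w0 : \forall w \near planemap c z, w.2 != 0.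
  have : nbhs (planemap c z).2 [set x : R | x != 0].
    by apply: open_nbhs_nbhs; split => //; exact: open_neq.
  exact: snd_continuous.
have gK : \forall w \near planemap c z, Kplus c (g w) := gz _ Kz.
change (\forall w \near planemap c z, Kplus c w).
apply: filterS2 gK w0 => w Kg w20.
by move: Kg => /(Kplus_iter _ _ 1); rewrite /= /planemap /g/= mulrC divfK// subrK; case: (w).
Qed.

(* Both coefficients of [T (n + 2) - t (n + 2) =
   T (n + 1) * (T n - t n) + t n * (T (n + 1) - t (n + 1))] exceed 1/2, the first
   one by at least [d]. *)
Lemma gap_growth (R : realType) (t T k : nat -> R) (d : R) :
  0 < d -> (forall n, t n.+2 = t n.+1 * t n + k n) ->
  (forall n, T n.+2 = T n.+1 * T n + k n) -> (forall n, 1 / 2 < t n) ->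
  t 0%N + d <= T 0%N -> t 1%N + d <= T 1%N ->
  forall n, t n.*2 + (d + n%:R * d ^+ 2) <= T n.*2 /\
            t n.*2.+1 + (d + n%:R * d ^+ 2) <= T n.*2.+1.
Proof.
move=> d0 ht hT t2 h0 h1; elim=> [|n [n0 n1]]; first by rewrite mul0r addr0.
have step (i : nat) (m : R) : d <= m -> t i + m <= T i -> t i.+1 + m <= T i.+1 ->
    t i.+2 + (m + d ^+ 2) <= T i.+2.
  move=> dm i0 i1; rewrite ht hT.
  have e : T i.+1 * T i - t i.+1 * t i =
    T i.+1 * (T i - t i) + t i * (T i.+1 - t i.+1) by ring.
  have b1 : (1 / 2 + d) * m <= T i.+1 * (T i - t i).
    by have ? := t2 i.+1; apply: ler_pM; lra.
  have b2 : 1 / 2 * m <= t i * (T i.+1 - t i.+1).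
    by have ? := t2 i; apply: ler_pM; lra.
  have : d * d <= d * m by rewrite ler_pM2l.
  rewrite expr2; lra.
set m := d + n%:R * d ^+ 2 in n0 n1 *.
have dm : d <= m by rewrite lerDl mulr_ge0// sqr_ge0.
have -> : d + n.+1%:R * d ^+ 2 = m + d ^+ 2 by rewrite /m -natr1; ring.
have s2 := step _ _ dm n0 n1; rewrite doubleS; split=> //.
have d2 : 0 <= d ^+ 2 by exact: sqr_ge0.
by apply: step => //; lra.
Qed.

Lemma expanding_not_interior (R : realType) (c : R) (z : R * R) (e : nat -> R) (N : nat) :
  0 < c -> c < 1 / 4 -> twist e ->
  (forall n, 1 / 2 < e (N + n)%N * orb c z (N + n)) -> ~ interior (Kplus c) z.
Proof.
move=> c0 c1 he hz Kz.
(* A zero would be followed by two terms equal to c < 1/2, and [orb_small] would keep the orbit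
   below 1/2, against [hz]. *)
have u0 n : orb c z n.+1 != 0.
  apply/eqP => un.
  have s2 : orb c z n.+2 = c by rewrite orb_rec un mul0r add0r.
  have s3 : orb c z n.+3 = c by rewrite orb_rec un mulr0 add0r.
  have c2 : c < 1 / 2 by lra.
  have := @orb_small _ c z n.+2 c0 c1; rewrite s2 s3 gtr0_norm// => /(_ c2 c2 N).
  have := hz n.+2; rewrite addnC => h.
  have : `|e (n.+2 + N)%N * orb c z (n.+2 + N)| = `|orb c z (n.+2 + N)|.
    by rewrite normrM (he _).1 mul1r.
  have := ler_norm (e (n.+2 + N)%N * orb c z (n.+2 + N)); lra.
have {}Kz : interior (Kplus c) (iter N (planemap c) z).
  elim: N {hz} => // n IH; rewrite iterS; apply: planemap_interior => //.
  by rewrite orbE /=.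
have [r r0 Hr] : exists2 r, 0 < r & ball (iter N (planemap c) z) r `<=` Kplus c.
  by move/nbhs_ballP: Kz => [r r0 Hr]; exists r.
pose d := r / 2; have d0 : 0 < d by rewrite divr_gt0.
pose e' n := e (N + n)%N; have he' : twist e' := twist_shift N he.
(* Moving each coordinate by [d] in the direction of its sign makes the signed sequences differ by
   exactly [d] at the two initial indices. *)
pose w := (orb c z N.+1 + d * e' 1%N, orb c z N + d * e' 0%N).
have Kw : Kplus c w.
  have dr x i : `|x - (x + d * e' i)| < r.
    rewrite opprD addrA subrr add0r normrN normrM (he' i).1 mulr1 gtr0_norm//.
    by rewrite /d; lra.
  by apply: Hr; rewrite orbE -ball_normE /= prod_normE/= gt_max !dr.
have /KplusP[M HM] := Kw.
pose t n := e' n * orb c z (N + n).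
pose T n := e' n * orb c w n.
have ht n : t n.+2 = t n.+1 * t n + e' n.+2 * c.
  apply: (twist_rec (u := fun n => orb c z (N + n)) he') => i.
  by rewrite !addnS.
have hT := twist_rec he' (orb_rec c w).
have sq := twist_sqr _ he'.
have T0 : t 0%N + d <= T 0%N.
  by rewrite /t /T addn0 /orb/= -/(orb _ _ _) mulrDr mulrCA sq mulr1.
have T1 : t 1%N + d <= T 1%N.
  by rewrite /t /T addn1 /orb/= -/(orb _ _ _) mulrDr mulrCA sq mulr1.
have G := gap_growth d0 ht hT hz T0 T1.
(* At index 2k the gap exceeds k d^2 > M, although [T] is at most M there and [t] is positive. *)
have [k hk] := nat_ltr (M / d ^+ 2).
have G0 : t k.*2 + (d + k%:R * d ^+ 2) <= T k.*2 := (G k).1.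
have : M < k%:R * d ^+ 2 by rewrite -ltr_pdivrMr// exprn_gt0.
have TM : T k.*2 <= M.
  rewrite (le_trans (ler_norm _))// normrM (he' _).1 mul1r; exact: HM.
have tk : 1 / 2 < t k.*2 := hz _.
lra.
Qed.

(** The margin r - 1/2 absorbs the distance between the two orbits once it is small. *)
Lemma expanding_Ws (R : realType) (c : R) (q z : R * R) (e : nat -> R) (r : R) :
  0 < c -> c < 1 / 4 -> twist e -> 1 / 2 < r ->
  (forall n, r <= e n * orb c q n) -> Ws c q z -> ~ interior (Kplus c) z.
Proof.
move=> c0 c1 he r2 hq /WsP.
have d0 : 0 < r - 1 / 2 by lra.
move=> /cvgr0Pnorm_lt/(_ _ d0)[N _ HN].
apply: (@expanding_not_interior _ c z e N) => // n.
have := HN (N + n)%N (leq_addr _ _); rewrite /= -[`|_|]mul1r -(he (N + n)%N).1 -normrM.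
rewrite mulrBr ltr_norml => /andP[h _].
have := hq (N + n)%N; lra.
Qed.

Lemma orb_iter_p3 (R : realType) (c : R) (j n : nat) :
  orb c (iter j (planemap c) (p3 R)) n = per3 c (j + n).
Proof. by rewrite orb_iter orb_p3. Qed.

(** With the signs shifted by [j], the signed cycle takes the values 1 and 1 + c, so the lower bound
    1 serves. *)
Lemma Ws_p3_not_interior (R : realType) (c : R) (j : nat) (z : R * R) :
  0 < c -> c < 1 / 4 -> Ws c (iter j (planemap c) (p3 R)) z ->
  ~ interior (Kplus c) z.
Proof.
move=> c0 c1; apply: (@expanding_Ws _ c _ _ (fun n => pat3 R (j + n)%N) 1) => //.
- exact: twist_shift (@twist_pat3 R).
- by lra.
- move=> n; rewrite orb_iter_p3 /pat3 /per3; case: ifP => _; lra.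
Qed.

Lemma Ws_theta_not_interior (R : realType) (c : R) (z : R * R) :
  0 < c -> c < 1 / 4 -> Ws c (theta c) z -> ~ interior (Kplus c) z.
Proof.
move=> c0 c1; have [_ _ a2 _ aE] := fixpoints c0 c1.
apply: (@expanding_Ws _ c _ _ (fun=> 1) (Defs.a2 c)) => //; first exact: twist1.
by move=> n; rewrite mul1r (orb_fix _ aE).
Qed.

(** * Decomposition of [Kplus], its interior and its boundary *)

Lemma Kplus_fix (R : realType) (c a : R) : a * a + c = a -> Kplus c (a, a).
Proof. by move=> aE; apply/KplusP; exists `|a| => n; rewrite orb_fix. Qed.

Lemma Kplus_p3 (R : realType) (c : R) (j : nat) :
  0 < c -> Kplus c (iter j (planemap c) (p3 R)).
Proof.
move=> c0; apply/KplusP; exists (1 + c) => n.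
rewrite orb_iter_p3 /per3; case: ifP => _; first by rewrite ger0_norm//; lra.
by rewrite normrN normr1; lra.
Qed.

Unset Implicit Arguments.

Theorem theorem3p4 (R : realType) (c : R) (hc0 : 0 < c) (hc1 : c < 1 / 4) :
  [/\ Kplus c =
        Ws c (alpha c) `|` Ws c (theta c) `|` Ws c (p3 R)
          `|` Ws c (planemap c (p3 R))
          `|` Ws c (planemap c (planemap c (p3 R))),
      Ws c (alpha c) = interior (Kplus c)
    & boundary (Kplus c) =
        Ws c (theta c) `|` Ws c (p3 R)
          `|` Ws c (planemap c (p3 R))
          `|` Ws c (planemap c (planemap c (p3 R)))].
Proof.
have [_ _ _ e1 e2] := fixpoints hc0 hc1.
pose S := Ws c (theta c) `|` Ws c (p3 R) `|` Ws c (planemap c (p3 R))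
  `|` Ws c (planemap c (planemap c (p3 R))).
(* The three equalities follow from this inclusion, [KS], [Ws_alpha_interior] and the closedness of
   [Kplus]. *)
have SK : S `<=` Kplus c `\` interior (Kplus c).
  move=> z [[[h|h]|h]|h]; split.
  - exact: Ws_Kplus (Kplus_fix e2) h.
  - exact: Ws_theta_not_interior h.
  - exact: Ws_Kplus (Kplus_p3 0 hc0) h.
  - exact: (@Ws_p3_not_interior _ c 0).
  - exact: Ws_Kplus (Kplus_p3 1 hc0) h.
  - exact: (@Ws_p3_not_interior _ c 1).
  - exact: Ws_Kplus (Kplus_p3 2 hc0) h.
  - exact: (@Ws_p3_not_interior _ c 2).
have KS z : Kplus c z -> Ws c (alpha c) z \/ S z.
  move=> /(bounded_Ws hc0 hc1)[h|h|[[|[|[|]]] // _ h]]; first by left.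
  - by right; left; left; left.
  - by right; left; left; right.
  - by right; left; right.
  - by right; right.
have aI : Ws c (alpha c) = interior (Kplus c).
  apply/seteqP; split; first exact: Ws_alpha_interior.
  by move=> z Iz; have [//|/SK[]] := KS z (interior_subset Iz).
split=> //.
- rewrite (_ : _ `|` _ `|` _ = Ws c (alpha c) `|` S); last by rewrite /S !setUA.
  apply/seteqP; split=> z; first exact: KS.
  by move=> [|/SK[]//]; rewrite aI; exact: interior_subset.
- rewrite /boundary -(proj1 (closure_id _) (Kplus_closed hc0 hc1)).
  apply/seteqP; split=> z; last exact: SK.
  by move=> [/KS[|//]]; rewrite aI.
Qed.
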